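(* For every integer $n\ge 0$, $$c_n^B = \sum_{k=0}^{n} L_B(n,k)\, C_k^B \qquad\text{and}\qquad C_n^B = \sum_{k=0}^{n} (-1)^{n-k} L_B(n,k)\, c_k^B .$$
   Context: The type $B$ falling factorial is $(x)_n^B = (x-1)(x-3)(x-5)\cdots(x-2n+1)$ for $n\ge 1$, with $(x)_0^B = 1$. The type $B$ rising factorial is $[x]_n^B = (x+1)(x+3)(x+5)\cdots(x+2n-1)$ for $n\ge 1$, with $[x]_0^B = 1$. The type $B$ Cauchy numbers of the first kind are $C_n^B = \int_0^1 (x)_n^B\,dx$, and those of the second kind are $c_n^B = \int_0^1 [x]_n^B\,dx$, for $n\ge 0$. The type $B$ Lah numbers are $L_B(n,k) = \binom{n}{k}^2\, 2^{n-k}\,(n-k)!$ for $0\le k\le n$. *)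

(* Defs.v *)
From mathcomp Require Import all_boot all_order all_algebra.
From mathcomp Require Import all_classical all_reals all_analysis.

Set Implicit Arguments.
Unset Strict Implicit.
Unset Printing Implicit Defensive.

Import Order.TTheory GRing.Theory Num.Theory.

Local Open Scope classical_set_scope.
Local Open Scope ring_scope.

(* The i-th factor, counted from 0, is x - (2i+1), so the last one for n >= 1
   is x - (2n-1) = x - 2n + 1; the empty product gives the value 1 at n = 0. *)
Definition fallingB (R : realType) (n : nat) (x : R) : R :=
  \prod_(i < n) (x - (2 * i + 1)%:R).

Definition risingB (R : realType) (n : nat) (x : R) : R :=
  \prod_(i < n) (x + (2 * i + 1)%:R).

Definition cauchyB1 (R : realType) (n : nat) : R :=
  \int[lebesgue_measure]_(x in `[0, 1]) fallingB n x.

Definition cauchyB2 (R : realType) (n : nat) : R :=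
  \int[lebesgue_measure]_(x in `[0, 1]) risingB n x.

Definition lahB (n k : nat) : nat :=
  ('C(n, k) ^ 2 * 2 ^ (n - k) * (n - k)`!)%N.

(* Main.v *)
Require Import Defs.
From mathcomp Require Import all_boot all_order all_algebra.
From mathcomp Require Import all_classical all_reals all_analysis.
From mathcomp Require Import ring zify.

Import GRing.Theory.

Local Open Scope ring_scope.

(** The type B Lah numbers are the connection coefficients between the rising
    and the falling factorials, so both formulas are integrated polynomial
    identities.

    Multiplying (x)_k^B by the new factor x + (2n+1) of the rising factorial and
    splitting that factor as (x - (2k+1)) + 2(n+k+1) sends (x)_k^B to
    (x)_{k+1}^B + 2(n+k+1) (x)_k^B.  The Lah numbers obey the matching
    recurrence [lahBSS], so induction on n gives [risingB_lahB]:
    [x]_n^B is the sum of the L_B(n,k) (x)_k^B.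

    The reflection x |-> -x exchanges the two families up to the sign (-1)^n, so
    the inverse expansion [fallingB_lahB] is the same identity evaluated at -x.

    Both families consist of continuous functions, hence integrable on [0, 1],
    and linearity of the integral concludes. *)

(** * Recurrence of the type B Lah numbers *)

Lemma lahB_small (n k : nat) : (n < k)%N -> lahB n k = 0%N.
Proof. by move=> nk; rewrite /lahB bin_small. Qed.

Lemma lahBS0 (n : nat) : lahB n.+1 0 = (2 * n.+1 * lahB n 0)%N.
Proof. by rewrite /lahB !bin0 !subn0 !exp1n !mul1n factS expnS mulnACA. Qed.

(** For k < n, after division by 2^m m! with m = n - k - 1, this is the square of
    Pascal's rule times 2(n-k): the cross term 2 'C(n, k) 'C(n, k+1) becomes a multiple of
    'C(n, k+1)^2 through (k+1) 'C(n, k+1) = (n-k) 'C(n, k). *)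
Lemma lahBSS (n k : nat) :
  lahB n.+1 k.+1 = (lahB n k + 2 * (n + k.+1).+1 * lahB n k.+1)%N.
Proof.
have [nk|kn] := leqP n k.
  rewrite (@lahB_small n k.+1) // muln0 addn0 /lahB subSS binS.
  by rewrite (@bin_small n k.+1).
have [m ->] : exists m, n = (k + m.+1)%N by exists (n - k.+1)%N; lia.
have := mul_bin_left (k + m.+1) k.
rewrite /lahB binS subSS addKn (_ : k + m.+1 - k.+1 = m)%N; last by lia.
move: 'C(_, k) 'C(_, k.+1) => a b ab.
rewrite factS (expnS 2) -!mulnn; move: (2 ^ m)%N m`! => p f.
have cross : (m.+1 * ((b + a) * (b + a)) =
    m.+1 * (a * a) + (k + m.+1 + k.+1).+1 * (b * b))%N.
  by have := congr1 (muln b) ab; lia.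
have := congr1 (muln (2 * p * f)) cross; lia.
Qed.

(** * Expansions of the factorials in one another *)

(** Splitting the new factor as (x - (2k+1)) + 2(n+k+1) turns the expansion of
    [x]_n^B into two sums, one with raised index k+1 and one with index k; their
    coefficients are the two terms of [lahBSS]. *)
Lemma risingB_lahB {R : realType} (n : nat) (x : R) :
  risingB n x = \sum_(k < n.+1) (lahB n k)%:R * fallingB k x.
Proof.
elim: n => [|n IHn]; first by rewrite big_ord1 /risingB /fallingB !big_ord0 mulr1.
have fallingS k : fallingB k x * (x + (2 * n + 1)%:R) =
    fallingB k.+1 x + (2 * (n + k).+1)%:R * fallingB k x.
  by rewrite {2}/fallingB big_ord_recr /= -/(fallingB k x); ring.
rewrite {1}/risingB big_ord_recr /= -/(risingB n x) IHn mulr_suml.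
under [in LHS]eq_bigr => k _ do rewrite -mulrA fallingS mulrDr.
rewrite big_split /= [RHS]big_ord_recl /=.
under [in RHS]eq_bigr => k _ do
  rewrite /bump /= add1n lahBSS natrD mulrDl.
rewrite big_split /= addrCA; congr (_ + _).
(* The missing term k = n+1 vanishes with lahB n n.+1. *)
have -> : \sum_(k < n.+1) (lahB n k)%:R * ((2 * (n + k).+1)%:R * fallingB k x) =
    \sum_(k < n.+2) (lahB n k)%:R * ((2 * (n + k).+1)%:R * fallingB k x).
  by rewrite [RHS]big_ord_recr /= (@lahB_small n n.+1) // mul0r addr0.
rewrite big_ord_recl /= lahBS0 addn0; congr (_ + _).
  by rewrite [in RHS]natrM mulrCA mulrA.
by apply: eq_bigr => k _; rewrite /bump /= add1n [in RHS]natrM mulrCA mulrA.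
Qed.

Lemma fallingBN {R : realType} (n : nat) (x : R) :
  fallingB n (- x) = (-1) ^+ n * risingB n x.
Proof.
rewrite /fallingB; under eq_bigr => i _ do rewrite -opprD.
by rewrite prodrN card_ord.
Qed.

Lemma fallingB_lahB {R : realType} (n : nat) (x : R) :
  fallingB n x =
  \sum_(k < n.+1) (-1) ^+ (n - k) * (lahB n k)%:R * risingB k x.
Proof.
rewrite -{1}[x]opprK fallingBN risingB_lahB mulr_sumr.
apply: eq_bigr => k _.
have kn : (k <= n)%N by rewrite -ltnS.
by rewrite fallingBN -{1}(subnK kn) exprD mulrACA signrMK.
Qed.

(** * Integration *)

Lemma Rintegral_lincomb {d} {T : measurableType d} {R : realType}
    (mu : {measure set T -> \bar R}) (D : set T) (n : nat)
    (c : nat -> R) (f : nat -> T -> R) :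
  measurable D -> (forall k, mu.-integrable D (EFin \o f k)) ->
  \int[mu]_(x in D) (\sum_(k < n) c k * f k x) =
  \sum_(k < n) c k * \int[mu]_(x in D) f k x.
Proof.
move=> mD intf.
have intcf k : mu.-integrable D (EFin \o (fun x => c k * f k x)).
  exact: (integrableZl mD (c k) (intf k)).
elim: n => [|n IHn].
  rewrite big_ord0; under eq_Rintegral do rewrite big_ord0.
  by rewrite Rintegral_cst // mul0r.
rewrite big_ord_recr -IHn /= -RintegralZl // -RintegralD //.
  by apply: eq_Rintegral => x _; rewrite big_ord_recr.
apply: (eq_integrable mD (fun x => \sum_(k < n) (c k * f k x)%:E)%E).
  by move=> x _; rewrite /= sumEFin.
by apply: integrable_sum => // k _; exact: (intcf k).
Qed.

Lemma fallingB_integrable {R : realType} (n : nat) :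
  lebesgue_measure.-integrable `[0, 1]%classic (EFin \o @fallingB R n).
Proof.
apply: continuous_compact_integrable; first exact: segment_compact.
apply: continuous_subspaceT.
apply: (@continuous_big _ _ _ _ xpredT) => [|i _ x].
  exact: mul_continuous.
by apply: cvgB; [exact: cvg_id|exact: cvg_cst].
Qed.

Lemma risingB_integrable {R : realType} (n : nat) :
  lebesgue_measure.-integrable `[0, 1]%classic (EFin \o @risingB R n).
Proof.
apply: continuous_compact_integrable; first exact: segment_compact.
apply: continuous_subspaceT.
apply: (@continuous_big _ _ _ _ xpredT) => [|i _ x].
  exact: mul_continuous.
by apply: cvgD; [exact: cvg_id|exact: cvg_cst].
Qed.

Theorem theorem2p13 (R : realType) (n : nat) :
  cauchyB2 R n = \sum_(k < n.+1) (lahB n k)%:R * cauchyB1 R k /\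
  cauchyB1 R n = \sum_(k < n.+1) (-1) ^+ (n - k) * (lahB n k)%:R * cauchyB2 R k.
Proof.
split.
- rewrite /cauchyB2; under eq_Rintegral do rewrite risingB_lahB.
  apply: (Rintegral_lincomb _ _ _ (fun k => (lahB n k)%:R)) => //.
  exact: fallingB_integrable.
- rewrite /cauchyB1; under eq_Rintegral do rewrite fallingB_lahB.
  apply: (Rintegral_lincomb _ _ _ (fun k => (-1) ^+ (n - k) * (lahB n k)%:R)) => //.
  exact: risingB_integrable.
Qed.
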